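(* Let $\kappa$ be an infinite cardinal. Every Baire space $X$ that has a $\kappa$-witnessing family is Baire $\kappa$-resolvable.
   Context: A set is meager if it is a countable union of nowhere dense sets; $X$ is a Baire space if no nonempty open subset is meager. $A\subseteq X$ is nowhere meager if $A\cap U$ is non-meager for every nonempty open $U$, and somewhere meager otherwise. A $\kappa$-witnessing family for $X$ is a family $\mathcal K\subseteq\wp(X)$ with $|\mathcal K|\le\kappa$, $|K|\ge\kappa$ for each $K\in\mathcal K$, and such that for every somewhere meager $A\subseteq X$ there is $K\in\mathcal K$ with $K\cap A=\varnothing$. $X$ is Baire $\kappa$-resolvable if it admits a partition $\{A_\iota:\iota<\kappa\}$ into nowhere meager sets. *)

(* Defs.v *)
From HB Require Import structures.
From mathcomp Require Import all_boot all_order all_algebra.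
From mathcomp Require Import all_classical.
From mathcomp Require Import topology.

Set Implicit Arguments.
Unset Strict Implicit.
Unset Printing Implicit Defensive.

Local Open Scope classical_set_scope.
Local Open Scope card_scope.

Section BaireResolvability.
Context {X : topologicalType}.
Implicit Types A U : set X.

Definition nowhere_dense A := interior (closure A) = set0.

Definition meager A :=
  exists2 F : nat -> set X, forall n, nowhere_dense (F n) & A = \bigcup_n F n.

Definition nowhere_meager A :=
  forall U, open U -> U !=set0 -> ~ meager (A `&` U).

Definition somewhere_meager A := ~ nowhere_meager A.

End BaireResolvability.

Definition Baire_space (X : topologicalType) :=
  forall U : set X, open U -> U !=set0 -> ~ meager U.

(* Below, a cardinal is given by a type kappa of that cardinality. *)

Definition witnessing_family (kappa : Type) (X : topologicalType)
    (KK : set (set X)) :=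
  [/\ KK #<= [set: kappa],
      forall K, KK K -> [set: kappa] #<= K &
      forall A : set X, somewhere_meager A ->
        exists2 K, KK K & K `&` A = set0].

(* Classical_sets' [partition] also asks the pieces to be nonempty; this is
   automatic for nowhere meager pieces of a nonempty space, see
   [Baire_resolvable_partition], and impossible if X is empty. *)
Definition Baire_resolvable (kappa : Type) (X : topologicalType) :=
  exists A : kappa -> set X,
    [/\ \bigcup_i A i = [set: X],
        trivIset [set: kappa] A &
        forall i, nowhere_meager (A i)].

Lemma nowhere_meager_nonempty (X : topologicalType) (A : set X) :
  [set: X] !=set0 -> nowhere_meager A -> A !=set0.
Proof.
move=> X0 /(_ _ openT X0) nA; apply: contrapT => /set0P/negP; rewrite negbK.
move=> /eqP A0; apply: nA; rewrite A0 set0I; exists (fun=> set0).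
  by move=> _; rewrite /nowhere_dense closure0 interior0.
by rewrite bigcup0.
Qed.

Lemma Baire_resolvable_partition (kappa : Type) (X : topologicalType) :
  [set: X] !=set0 -> Baire_resolvable kappa X ->
  exists2 A : kappa -> set X,
    partition [set: kappa] A [set: X] & forall i, nowhere_meager (A i).
Proof.
move=> X0 [A [cA tA nA]]; exists A => //; split=> // i _.
exact: nowhere_meager_nonempty (nA i).
Qed.

(* Main.v *)
Require Import Defs.
From Stdlib Require Inverse_Image.
From HB Require Import structures.
From mathcomp Require Import all_boot all_order all_algebra.
From mathcomp Require Import all_classical.
From mathcomp Require Import topology.
From mathcomp Require wochoice.

Local Open Scope classical_set_scope.
Local Open Scope card_scope.

(** Bernstein's construction. Well-order [kappa] by its initial ordinal. Since
    [kappa * kappa = kappa], the pairs (K, i) with K in the witnessing family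
    and i in [kappa] are enumerated in type [kappa], so one can choose
    recursively pairwise distinct points f (K, i) in K: fewer than [kappa]
    points are used up at each step, and K has at least [kappa] points. Colour
    f (K, i) by i and all other points arbitrarily. Every colour class meets
    every K, hence is not somewhere meager. *)

(** * Cardinal comparison through injections *)

Section Cardinals.
Implicit Types T U V : Type.

Lemma set_inj_card_le {T U} {A : set T} {B : set U} {f : T -> U} :
  set_fun A B f -> set_inj A f -> A #<= B.
Proof.
move=> fAB fI.
suff [g] : $|{injfun A >-> B}| by exact: (inj_card_le g).
by apply/injfunPex; exists f.
Qed.

(** Since [f] is total, it needs values off [A] even when [B] is empty; [y0] ensures that [U] has
    one. *)
Lemma card_le_set_inj {T U} {A : set T} {B : set U} (y0 : U) :
  A #<= B -> exists2 f : T -> U, set_fun A B f & set_inj A f.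
Proof.
elim/Ppointed: U => U in B y0 *; first by case: (no y0).
by move=> /pcard_leP/injfunPex.
Qed.

Lemma card_le_setX_inh {T T' U U'} {A : set T} {A' : set T'} {B : set U}
    {B' : set U'} (u : U) (u' : U') :
  A #<= B -> A' #<= B' -> A `*` A' #<= B `*` B'.
Proof.
move=> /(card_le_set_inj u)[f fAB fI] /(card_le_set_inj u')[g gAB gI].
apply: (set_inj_card_le (f := fun p => (f p.1, g p.2))).
  by move=> [x y] [/= Ax Ay]; split=> /=; [exact: fAB|exact: gAB].
move=> [x y] [x' y']; rewrite !inE => -[/= Ax Ay] [/= Ax' Ay'] [fE gE].
by congr (_, _); [apply: fI|apply: gI]; rewrite ?inE.
Qed.

Lemma infinite_setU1_card_le {T} (A : set T) (x : T) :
  infinite_set A -> x |` A #<= A.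
Proof.
move=> /infiniteP/(card_le_set_inj x)[s sA sI].
have {}sA n : A (s n) by exact: sA.
have {}sI m n : s m = s n -> m = n by apply: sI; rewrite inE.
have [Ax|nAx] := pselect (A x); first by apply: subset_card_le => y [->|].
(* Hilbert's hotel: x moves to s 0 and s n to s n.+1. *)
have /choice[h hP] y : exists z, [\/ y = x /\ z = s 0,
    exists2 n, y = s n & z = s n.+1 |
    [/\ y <> x, forall n, y <> s n & z = y]].
  have [->|yx] := pselect (y = x); first by exists (s 0); apply: Or31.
  have [[n ->]|ns] := pselect (exists n, y = s n).
    by exists (s n.+1); apply: Or32; exists n.
  by exists y; apply: Or33; split=> // n yE; apply: ns; exists n.
apply: (set_inj_card_le (f := h)).
  move=> y [->|Ay].
    by case: (hP x) => [[_ ->]|[n _ ->]|[]].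
  by case: (hP y) => [[_ ->]|[n _ ->]|[_ _ ->]].
move=> y z _ _.
case: (hP y) => [[-> ->]|[n -> ->]|[yx ns ->]];
  case: (hP z) => [[-> ->]|[m -> ->]|[zx ms ->]] //.
- by move/sI.
- by move/esym/ms.
- by move/sI.
- by move/sI => -[->].
- by move/esym/ms.
- by move/ns.
- by move/ns.
Qed.

End Cardinals.

(** * Well-orders and recursive choice along them *)

Definition strict_well_order {T : Type} (lt : T -> T -> Prop) :=
  well_founded lt /\ forall x y, [\/ lt x y, x = y | lt y x].

Lemma strict_well_order_exists (T : Type) :
  exists lt : T -> T -> Prop, strict_well_order lt.
Proof.
have [R Rwo] := wochoice.well_ordering_principle {classic T}.
have Rmin (P : set T) x : P x ->
    exists2 z, P z & forall y, P y -> R z y.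
  move=> Px; have [|z [[zP zmin] _]] := Rwo (fun y : T => `[< P y >]).
    by exists x; apply/asboolP.
  exists z; first exact/asboolP.
  by move=> y Py; apply: zmin; apply/asboolP.
have Rtot x y : R x y \/ R y x.
  have [z [->|->] zmin] := Rmin [set x; y] x (or_introl erefl).
    by left; apply: zmin; right.
  by right; apply: zmin; left.
(* Both [x] and [y] are then minima of the pair, and [Rwo] makes minima unique. *)
have Ranti x y : R x y -> R y x -> x = y.
  move=> xy yx; have [|z [_ zmin]] := Rwo (fun u : T => `[< [set x; y] u >]).
    by exists x; apply/asboolP; left.
  have Rxx u : R u u by case: (Rtot u u).
  have <- : z = x.
    apply: zmin; split; first by apply/asboolP; left.
    by move=> u /asboolP[->|->].
  apply: zmin; split; first by apply/asboolP; right.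
  by move=> u /asboolP[->|->].
exists (fun x y : T => R x y /\ x <> y); split.
  move=> x; apply: contrapT => nx.
  have [z nz zmin] := Rmin [set x | ~ Acc (fun x y : T => R x y /\ x <> y) x] x nx.
  apply: nz; constructor=> y [yz neq]; apply: contrapT => /zmin zy.
  by apply: neq; exact: Ranti.
move=> x y; have [->|xy] := pselect (x = y); first exact: Or32.
by case: (Rtot x y) => ?; [apply: Or31|apply: Or33; split=> // yx; apply: xy].
Qed.

(** By trichotomy, a failure of transitivity would close a cycle of length two or three, which
    well-foundedness excludes. *)
Lemma strict_well_order_trans {T : Type} {lt : T -> T -> Prop} :
  strict_well_order lt -> forall {x y z}, lt x y -> lt y z -> lt x z.
Proof.
move=> [wf tri] x y z xy yz.
have cycle2 a : forall b, lt a b -> ~ lt b a.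
  by elim: (wf a) => {}a _ IH b ab ba; exact: (IH b ba a ba ab).
have cycle3 a : forall b c, lt a b -> lt b c -> ~ lt c a.
  by elim: (wf a) => {}a _ IH b c ab bc ca; exact: (IH c ca a b ca ab bc).
case: (tri x z) => // [xz|zx]; last by case: (cycle3 _ _ _ xy yz).
by rewrite xz in xy; case: (cycle2 _ _ xy).
Qed.

(* A recursive choice along lt, avoiding at p the values at earlier points. *)
Lemma injective_choice {T X : Type} (lt : T -> T -> Prop) (S : set T)
    (K : T -> set X) (x0 : X) :
  well_founded lt ->
  (forall p q, S p -> S q -> [\/ lt p q, p = q | lt q p]) ->
  (forall p, S p -> ~ (K p #<= [set q | S q /\ lt q p])) ->
  exists2 f : T -> X, (forall p, S p -> K p (f p)) & set_inj S f.
Proof.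
move=> wf tri small.
pose avoid p (g : forall q, lt q p -> X) :=
  [set x | K p x /\ forall q (qp : lt q p), S q -> g q qp <> x].
pose F p g : X := xget (x0 : {classic X}) (avoid p g).
pose f := Fix wf (fun=> X) F.
have fE p : f p = F p (fun q _ => f q).
  rewrite /f Fix_eq // => q g h gh; congr F.
  by apply: functional_extensionality_dep => u; apply/funext => uq; exact: gh.
have fP p : S p -> K p (f p) /\ forall q, lt q p -> S q -> f q <> f p.
  move=> Sp; suff : avoid p (fun q _ => f q) (f p) by [].
  (* If no value were free, [K p] would lie in the image under [f] of the earlier points of [S],
     against [small]. So on [S] the default [x0] is never resorted to. *)
  rewrite fE /F; apply: xgetPex; apply: contrapT => none.
  apply: (small p Sp); apply: card_le_trans (card_image_le f _).
  apply: subset_card_le => x Kx; apply: contrapT => nx; apply: none.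
  exists x; split=> // q qp Sq fqx; apply: nx; exists q => //.
exists f => [p /fP[]//|p q]; rewrite !inE => Sp Sq fpq.
case: (tri p q Sp Sq) => // lt_pq.
  by case: (fP q Sq) => _ /(_ p lt_pq Sp).
by case: (fP p Sp) => _ /(_ q lt_pq Sq); rewrite fpq.
Qed.

Lemma lexicographic_well_order {T A B : Type} (ltA : A -> A -> Prop)
    (ltB : B -> B -> Prop) (f : T -> A) (g : T -> B) :
  strict_well_order ltA -> strict_well_order ltB -> injective g ->
  strict_well_order (fun p q => ltA (f p) (f q) \/ f p = f q /\ ltB (g p) (g q)).
Proof.
move=> [wfA triA] [wfB triB] gI; split; last first.
  move=> p q; case: (triA (f p) (f q)) => [?|fE|?].
  - by apply: Or31; left.
  - case: (triB (g p) (g q)) => [?|/gI|?]; first by apply: Or31; right.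
      exact: Or32.
    by apply: Or33; right.
  - by apply: Or33; left.
suff acc a b p : f p = a -> g p = b ->
    Acc (fun p q => ltA (f p) (f q) \/ f p = f q /\ ltB (g p) (g q)) p.
  by move=> p; exact: acc.
(* Nested induction: the statement is kept general in [b], so that a drop in the first key may
   change the second one freely. *)
elim: (wfA a) b p => {}a _ IHa b; elim: (wfB b) => {}b _ IHb p fp gp.
constructor=> q [|[]]; first by rewrite fp => /IHa; apply.
by rewrite fp gp => fq /IHb; apply.
Qed.

(** * The square of an infinite cardinal *)

Section InitialSegments.
Context {W : Type} {lt : W -> W -> Prop}.
Hypothesis wo : strict_well_order lt.
Implicit Types S : set W.

Let seg a : set W := [set b | lt b a].
Let lower S := forall a b, S a -> lt b a -> S b.

(** This [S] plays the initial ordinal of [W]: the segment below the least point whose segment is as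
    large as [W], or all of [W] if there is no such point. *)
Lemma setT_initial_segment : exists2 S, lower S /\ [set: W] #<= S &
  forall a, S a -> ~ ([set: W] #<= seg a).
Proof.
have [[a0 a0P]|small] := pselect (exists a, [set: W] #<= seg a); last first.
  by exists setT => // a _ aT; apply: small; exists a.
have [wf _] := wo; elim: (wf a0) a0P => a _ IH aT.
have [[b ba bT]|small] := pselect (exists2 b, lt b a & [set: W] #<= seg b).
  exact: IH bT.
exists (seg a); last by move=> b ba bT; apply: small; exists b.
by split=> // b c ba cb; exact: (strict_well_order_trans wo cb ba).
Qed.

(* S * S is ordered by the maximum first (Gödel's pairing order), so that every
   initial segment lies in the square of a proper initial segment of S. *)
Lemma lower_square_card_le S : lower S -> infinite_set S ->
  (forall a, S a -> infinite_set (seg a) -> seg a `*` seg a #<= seg a) ->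
  S `*` S #<= S.
Proof.
move=> lowS infS IH; have [w _] := infinite_setN0 infS.
have [[b Sb Sseg]|small] := pselect (exists2 b, S b & S #<= seg b).
  have infb : infinite_set (seg b) by move=> /(card_le_finite Sseg).
  apply: card_le_trans (card_le_setX_inh w w Sseg Sseg) _.
  apply: card_le_trans (IH b Sb infb) _.
  by apply: subset_card_le => c; exact: lowS.
have [_ tri] := wo.
pose mx (p : W * W) := if pselect (lt p.1 p.2) then p.2 else p.1.
(* An arbitrary well-order [ltP] breaks ties between pairs with the same maximum. *)
have [ltP woP] := strict_well_order_exists (W * W)%type.
have [wfG triG] := @lexicographic_well_order _ _ _ _ _ mx id wo woP (fun _ _ => id).
set ltG := (X in well_founded X) in wfG triG.
have le_mx1 p : p.1 = mx p \/ lt p.1 (mx p).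
  by rewrite /mx; case: pselect => ?; [right|left].
have le_mx2 p : p.2 = mx p \/ lt p.2 (mx p).
  rewrite /mx; case: pselect => ? /=; first by left.
  by case: (tri p.1 p.2) => // [->|?]; [left|right].
have [||f fS fI] := @injective_choice _ _ ltG (S `*` S) (fun=> S) w wfG.
- by move=> p q _ _; exact: triG.
- move=> p [Sp1 Sp2]; set m := mx p => Sle.
  have Sm : S m by rewrite /m /mx; case: pselect.
  pose M := m |` seg m.
  have {Sle} SM : S #<= M `*` M.
    apply: (card_le_trans Sle); apply: subset_card_le => q [_ qp].
    have leM x : x = mx q \/ lt x (mx q) -> M x.
      case: qp => [qm|[qm _]] [->|xq].
      + by right.
      + by right; exact: (strict_well_order_trans wo xq qm).
      + by left.
      + by right; rewrite /seg /= /m -qm.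
    by split; apply: leM.
  (* A finite segment would make [S] finite. For an infinite one, adding [m] does not enlarge it, so
     [IH] bounds [S] by a proper segment. *)
  have [fin|inf] := pselect (finite_set (seg m)).
    apply: infS; apply: card_le_finite SM _.
    by apply: finite_setX; rewrite /M finite_setU; split=> //; exact: finite_set1.
  apply: small; exists m => //; apply: (card_le_trans SM).
  apply: card_le_trans (IH m Sm inf).
  by apply: card_le_setX_inh => //; exact: infinite_setU1_card_le.
- by apply: set_inj_card_le fI => p; exact: fS.
Qed.

(** Well-founded induction on [a], as [seg a] is itself a lower set. *)
Lemma seg_square_card_le a : infinite_set (seg a) -> seg a `*` seg a #<= seg a.
Proof.
have [wf _] := wo; elim: (wf a) => {}a _ IH infa.
apply: lower_square_card_le => // b c ba cb.
exact: (strict_well_order_trans wo cb ba).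
Qed.

End InitialSegments.

Lemma infinite_square_card_le {T : Type} :
  infinite_set [set: T] -> [set: T] `*` [set: T] #<= [set: T].
Proof.
have [lt wo] := strict_well_order_exists T => infT.
by apply: (lower_square_card_le wo) => // a _; exact: seg_square_card_le.
Qed.

(** * Bernstein's construction *)

(* The injection h places KK * kappa inside an initial segment S of kappa all
   of whose proper initial segments are smaller than kappa. *)
Lemma disjoint_refinement {kappa X : Type} (KK : set (set X)) :
  infinite_set [set: kappa] -> KK #<= [set: kappa] ->
  (forall K, KK K -> [set: kappa] #<= K) -> X ->
  exists2 f : set X * kappa -> X,
    (forall K i, KK K -> K (f (K, i))) & set_inj (KK `*` [set: kappa]) f.
Proof.
move=> infk KKk Kk x0; have [i0 _] := infinite_setN0 infk.
have [lt wo] := strict_well_order_exists kappa.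
have [S [_ kS] small] := setT_initial_segment wo.
have [h hS hI] : exists2 h : set X * kappa -> kappa,
    set_fun (KK `*` [set: kappa]) S h & set_inj (KK `*` [set: kappa]) h.
  apply: (card_le_set_inj i0); apply: card_le_trans kS.
  apply: card_le_trans (infinite_square_card_le infk).
  exact: card_le_setX_inh.
have [wf tri] := wo.
have [||f fK fI] := @injective_choice _ _ (fun p q => lt (h p) (h q))
    (KK `*` [set: kappa]) fst x0 (Inverse_Image.wf_inverse_image _ _ _ h wf).
- move=> p q Sp Sq; case: (tri (h p) (h q)) => [?|hE|?]; first exact: Or31.
    by apply: Or32; apply: hI; rewrite ?inE.
  exact: Or33.
(* Pairs before [p] inject through [h] into the segment below [h p], which is smaller than
   [kappa]. *)
- move=> p KKp le_p; apply: (small (h p)); first exact: hS.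
  apply: card_le_trans (Kk _ KKp.1) _; apply: (card_le_trans le_p).
  apply: (set_inj_card_le (f := h)) => [q [_]//|q r].
  by rewrite !inE => -[KKq _] [KKr _]; apply: hI; rewrite inE.
- by exists f => // K i KKK; exact: (fK (K, i)).
Qed.

Theorem theorem4p12 (kappa : Type) (X : topologicalType) :
  infinite_set [set: kappa] ->
  Baire_space X ->
  (exists KK : set (set X), witnessing_family kappa KK) ->
  Baire_resolvable kappa X.
Proof.
move=> infk _ [KK [KKk Kk KKmeager]].
have [[x0 _]|X0] := pselect ([set: X] !=set0); last first.
  have noX (x : X) : False by apply: X0; exists x.
  by exists (fun=> set0); split=> [||_ U _ [x]];
    [apply/seteqP; split=> x|move=> i j _ _ [x]|]; case: (noX x).
have [i0 _] := infinite_setN0 infk.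
have [f fK fI] := disjoint_refinement KK infk KKk Kk x0.
(* The colour of a chosen point is unambiguous by injectivity of [f]; all other points get [i0]. *)
have /choice[c cP] x : exists i, forall K j, KK K -> f (K, j) = x -> j = i.
  have [[K [i [KKK fE]]]|nx] := pselect (exists K i, KK K /\ f (K, i) = x).
    exists i => L j KKL; rewrite -fE => /(fI (L, j) (K, i)).
    by rewrite !inE => /(_ (conj KKL I) (conj KKK I)) [].
  by exists i0 => K i KKK fE; case: nx; exists K, i.
exists (fun i => [set x | c x = i]); split.
- by apply/seteqP; split=> // x _; exists (c x).
- by move=> i j _ _ [x [/= <- <-]].
- move=> i; apply: contrapT => /KKmeager[K KKK K0].
  suff : (K `&` [set x | c x = i]) (f (K, i)) by rewrite K0.
  by split; [exact: fK|exact/esym/(cP _ K)].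
Qed.
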